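(* Let $\mathcal{D}_{\mathtt{inner}}$ denote a restricted decision diagram of $\mathcal{Y}$. Then the model $$\begin{aligned}\min_{\mathbf{x},\mathbf{y},\boldsymbol{\lambda}}\quad&\mathbf{c}^\top\mathbf{x}+\mathbf{d}^\top\boldsymbol{\lambda}\\ \text{s.t.}\quad&\mathbf{T}^\top\boldsymbol{\lambda}=\mathbf{y},\\ &\mathbf{y}\in\operatorname{proj}_{\mathbf{y}}(\mathrm{NF}(\mathcal{D}_{\mathtt{inner}})),\\ &\mathbf{y}\in\mathcal{S}(\mathbf{x}),\\ &\mathbf{x}\in\mathcal{X},\ \boldsymbol{\lambda}\ge\mathbf{0}\end{aligned}$$ generates a feasible solution $\mathbf{x}\in\mathcal{X}$ (the $\mathbf{x}$-component of any optimal solution), and its optimal value is an upper bound on the optimal objective value of $$\min_{\mathbf{x}\in\mathcal{X}}\ \max_{\boldsymbol{\xi}\in\Xi}\ \min_{\mathbf{y}\in\mathcal{Y}\cap\mathcal{S}(\mathbf{x})}\ \mathbf{c}^\top\mathbf{x}+\boldsymbol{\xi}^\top\mathbf{y}.$$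
   Context: Problem data: $m,n$ are positive integers, $\mathbf{c}\in\mathbb{R}^m$, $\mathcal{X}\subseteq\{0,1\}^m$, $\mathcal{Y}=\{\mathbf{y}\in\{0,1\}^n\mid\mathbf{G}\mathbf{y}\ge\mathbf{h}\}$ for a real matrix $\mathbf{G}$ and real vector $\mathbf{h}$, and $\Xi=\{\boldsymbol{\xi}\in\mathbb{R}^n\mid\mathbf{T}\boldsymbol{\xi}\le\mathbf{d}\}$ is a nonempty bounded polyhedron. The problem has selective adaptability: for pairwise disjoint $\mathcal{U}_1,\mathcal{U}_2,\mathcal{U}_3\subseteq\{1,\ldots,n\}\times\{1,\ldots,m\}$, $$\mathcal{S}(\mathbf{x})=\{\mathbf{y}\in\mathbb{R}^n\mid y_i\le x_j\ \forall(i,j)\in\mathcal{U}_1,\ y_i=x_j\ \forall(i,j)\in\mathcal{U}_2,\ y_i\ge x_j\ \forall(i,j)\in\mathcal{U}_3\}.$$ The minimum over an empty (infeasible) set is $+\infty$. Decision diagram: a directed acyclic (multi)graph $\mathcal{D}=(\mathcal{V},\mathcal{A})$ whose nodes are partitioned into $n+1$ nonempty layers $\mathcal{V}_1,\ldots,\mathcal{V}_{n+1}$ with $\mathcal{V}_1=\{\mathtt{r}\}$ and $\mathcal{V}_{n+1}=\{\mathtt{t}\}$; each arc goes from a node of $\mathcal{V}_i$ to a node of $\mathcal{V}_{i+1}$ for some $i\in\{1,\ldots,n\}$ and carries a label 0 or 1. $\mathcal{A}_i^1$ is the set of arcs with label 1 leaving nodes of $\mathcal{V}_i$. A path from $\mathtt{r}$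 to $\mathtt{t}$ maps to the vector $\mathbf{y}\in\{0,1\}^n$ with $y_i$ equal to the label of its arc leaving layer $i$. A restricted decision diagram of $\mathcal{Y}$ is one whose $\mathtt{r}$–$\mathtt{t}$ paths map to a strict subset of $\mathcal{Y}$. Network flow polyhedron: $$\mathrm{NF}(\mathcal{D})=\Big\{(\mathbf{y},\mathbf{z})\in\mathbb{R}^n\times\mathbb{R}_+^{|\mathcal{A}|}\ \Big|\ \mathbf{A}\mathbf{z}=\mathbf{b},\ y_i=\sum_{j\in\mathcal{A}_i^1}z_j\ \forall i\in\{1,\ldots,n\}\Big\},$$ where $\mathbf{A}\in\{-1,0,1\}^{|\mathcal{V}|\times|\mathcal{A}|}$ is the node-arc incidence matrix (entry $-1$ at the tail and $+1$ at the head of each arc), and $\mathbf{b}$ is zero except for $-1$ at $\mathtt{r}$ and $1$ at $\mathtt{t}$. $\operatorname{proj}_{\mathbf{y}}$ denotes projection onto the $\mathbf{y}$ coordinates. *)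

(* Defs.v *)
(* MathComp / MathComp-Analysis development over an arbitrary R : realType;
   vectors of R^k are column vectors 'cV[R]_k. *)
From HB Require Import structures.
From mathcomp Require Import all_boot all_order all_algebra.
From mathcomp Require Import all_classical all_reals all_analysis.

Set Implicit Arguments.
Unset Strict Implicit.
Unset Printing Implicit Defensive.

Import Order.TTheory GRing.Theory Num.Theory.
Import numFieldNormedType.Exports.

Local Open Scope classical_set_scope.
Local Open Scope ring_scope.

Section Vectors.
Variable R : realType.

Definition dot k (u v : 'cV[R]_k) : R := (u^T *m v) 0 0.

Definition vle k (u v : 'cV[R]_k) : Prop := forall i, u i 0 <= v i 0.

Definition binary k : set 'cV[R]_k :=
  [set v | forall i, v i 0 = 0 \/ v i 0 = 1].

End Vectors.

(* Layers are numbered from 0 to n. Acyclicity follows from dd_arc_layer.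
   Parallel arcs, with equal or different labels, are allowed. *)
Record decision_diagram (n : nat) := DecisionDiagram {
  dd_node : finType;
  dd_arc : finType;
  dd_tail : dd_arc -> dd_node;
  dd_head : dd_arc -> dd_node;
  dd_label : dd_arc -> bool;
  dd_layer : dd_node -> 'I_n.+1;
  dd_root : dd_node;
  dd_term : dd_node;
  dd_layer_nonempty : forall i : 'I_n.+1, exists v, dd_layer v = i;
  dd_layer_first : forall v, dd_layer v = ord0 <-> v = dd_root;
  dd_layer_last : forall v, dd_layer v = ord_max <-> v = dd_term;
  dd_arc_layer : forall a,
    (dd_layer (dd_head a) : nat) = (dd_layer (dd_tail a)).+1
}.

Section DecisionDiagrams.
Variables (R : realType) (n : nat) (D : decision_diagram n).

Fixpoint dd_walk (v : dd_node D) (s : seq (dd_arc D)) (w : dd_node D) : Prop :=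
  if s is a :: s' then dd_tail a = v /\ dd_walk (dd_head a) s' w else v = w.

(* Every arc goes up by exactly one layer, so a root-terminal path has exactly
   n arcs and its i-th arc is the one leaving layer i. *)
Definition dd_path (p : n.-tuple (dd_arc D)) : Prop :=
  dd_walk (dd_root D) p (dd_term D).

Definition dd_path_vector (p : n.-tuple (dd_arc D)) : 'cV[R]_n :=
  \col_i (dd_label (tnth p i))%:R.

Definition dd_solutions : set 'cV[R]_n := dd_path_vector @` dd_path.

Definition restricted_dd (Y : set 'cV[R]_n) : Prop := dd_solutions `<` Y.

(* The two indicators never overlap, the tail and head of an arc being in
   different layers; likewise in flow_balance when 0 < n. *)
Definition incidence : 'M[R]_(#|dd_node D|, #|dd_arc D|) :=
  \matrix_(v, a) ((dd_head (enum_val a) == enum_val v)%:R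
                  - (dd_tail (enum_val a) == enum_val v)%:R).

Definition flow_balance : 'cV[R]_#|dd_node D| :=
  \col_v ((enum_val v == dd_term D)%:R - (enum_val v == dd_root D)%:R).

Definition network_flow : set ('cV[R]_n * 'cV[R]_#|dd_arc D|) :=
  [set yz : 'cV[R]_n * 'cV[R]_#|dd_arc D| |
     [/\ vle 0 yz.2,
         incidence *m yz.2 = flow_balance
       & forall i : 'I_n, yz.1 i 0 =
           \sum_(j < #|dd_arc D| |
                 ((dd_layer (dd_tail (enum_val j)) : nat) == i)
                 && dd_label (enum_val j)) yz.2 j 0]].

Definition proj_y_network_flow : set 'cV[R]_n := fst @` network_flow.

End DecisionDiagrams.

Section TwoStage.
Variables (R : realType) (m n : nat).

Definition binary_polyhedral q (G : 'M[R]_(q, n)) (h : 'cV[R]_q)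
    : set 'cV[R]_n :=
  [set y | binary y /\ vle h (G *m y)].

Definition uncertainty_set p (T : 'M[R]_(p, n)) (d : 'cV[R]_p)
    : set 'cV[R]_n :=
  [set xi | vle (T *m xi) d].

Definition selective (U1 U2 U3 : {set 'I_n * 'I_m}) (x : 'cV[R]_m)
    : set 'cV[R]_n :=
  [set y | [/\ forall i j, (i, j) \in U1 -> y i 0 <= x j 0,
               forall i j, (i, j) \in U2 -> y i 0 = x j 0
             & forall i j, (i, j) \in U3 -> x j 0 <= y i 0]].

(* Optimal values live in \bar R: ereal_inf of the empty set is +oo, and
   ereal_inf / ereal_sup give the min / max whenever these are attained. *)
Definition second_stage_value (c : 'cV[R]_m) (Y : set 'cV[R]_n)
    (S : 'cV[R]_m -> set 'cV[R]_n) (x : 'cV[R]_m) (xi : 'cV[R]_n) : \bar R :=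
  ereal_inf [set (dot c x + dot xi y)%:E | y in Y `&` S x].

Definition worst_case_value (c : 'cV[R]_m) (Y Xi : set 'cV[R]_n)
    (S : 'cV[R]_m -> set 'cV[R]_n) (x : 'cV[R]_m) : \bar R :=
  ereal_sup [set second_stage_value c Y S x xi | xi in Xi].

Definition robust_value (c : 'cV[R]_m) (X : set 'cV[R]_m)
    (Y Xi : set 'cV[R]_n) (S : 'cV[R]_m -> set 'cV[R]_n) : \bar R :=
  ereal_inf [set worst_case_value c Y Xi S x | x in X].

(* A first-stage decision is feasible when it lies in X and its second stage
   is feasible, i.e. its inner minimum is not +oo. *)
Definition robust_feasible (X : set 'cV[R]_m) (Y : set 'cV[R]_n)
    (S : 'cV[R]_m -> set 'cV[R]_n) (x : 'cV[R]_m) : Prop :=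
  X x /\ Y `&` S x !=set0.

(* Points of the single-level model are triples (x, y, lambda). *)
Definition model_feasible p (T : 'M[R]_(p, n)) (X : set 'cV[R]_m)
    (S : 'cV[R]_m -> set 'cV[R]_n) (D : decision_diagram n)
    : set ('cV[R]_m * 'cV[R]_n * 'cV[R]_p) :=
  [set s | let: (x, y, lam) := s in
     [/\ T^T *m lam = y, proj_y_network_flow D y, S x y, X x & vle 0 lam]].

Definition model_objective p (c : 'cV[R]_m) (d : 'cV[R]_p)
    (s : 'cV[R]_m * 'cV[R]_n * 'cV[R]_p) : R :=
  let: (x, _, lam) := s in dot c x + dot d lam.

Definition model_value p (c : 'cV[R]_m) (T : 'M[R]_(p, n)) (d : 'cV[R]_p)
    (X : set 'cV[R]_m) (S : 'cV[R]_m -> set 'cV[R]_n)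
    (D : decision_diagram n) : \bar R :=
  ereal_inf [set (model_objective c d s)%:E | s in model_feasible T X S D].

Definition model_optimal p (c : 'cV[R]_m) (T : 'M[R]_(p, n)) (d : 'cV[R]_p)
    (X : set 'cV[R]_m) (S : 'cV[R]_m -> set 'cV[R]_n)
    (D : decision_diagram n) (s : 'cV[R]_m * 'cV[R]_n * 'cV[R]_p) : Prop :=
  model_feasible T X S D s /\
  forall s', model_feasible T X S D s' ->
    model_objective c d s <= model_objective c d s'.

End TwoStage.

(* Main.v *)
Require Import Defs.
From mathcomp Require Import all_boot all_order all_algebra.
From mathcomp Require Import all_classical all_reals all_analysis.
Import Order.TTheory GRing.Theory Num.Theory.
Import numFieldNormedType.Exports.
Local Open Scope classical_set_scope.
Local Open Scope ring_scope.

(** Fix a point [(x, y, lam)] of the single-level model, a flow [z] projecting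
    onto [y], and a scenario [xi] of the uncertainty set.

    Weak duality for the inner maximization gives
    [xi . y = (T xi) . lam <= d . lam] ([weak_duality]), so it is enough to
    replace the fractional recourse [y] by a recourse in [Y] that is allowed by
    [x] and costs no more than [y] under [xi].  Such a recourse is a path of
    the diagram: the flow is an average of the paths that run inside its
    support, so one of these paths costs at most the average.  This is
    obtained without decomposing the flow.  Let [phi v] be the least cost of
    reaching the terminal from [v] along arcs of the support.  Flow
    conservation paired with the potential [phi] ([flow_potential]) bounds the
    cost of the flow below by [phi] of the root, and following optimal arcs
    from the root, which cannot get stuck by conservation
    ([optimal_support_walk]), yields a path of that cost
    ([cheap_support_path]).

    The selected path still belongs to the linking set because [x] is binary:
    every linking constraint is then either void on binary vectors or fixes a
    coordinate of [y] at 0 or 1, and such a fixing is inherited by every path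
    in the support of the flow, since one unit of flow crosses each layer
    ([layer_flow], [support_path_fixed]).

    Hence every model-feasible [x] has a feasible recourse, and its worst-case
    cost is at most the model objective.  The path may depend on [xi], which is
    why no minimax theorem is involved. *)

(** * Unit flows in a decision diagram *)

(** The system [A z = b] with the flow indexed by the arcs themselves, which
    avoids the enumeration of arcs and nodes in the matrix form. *)
Definition unit_flow {R : realType} {n : nat} (D : decision_diagram n)
    (z : dd_arc D -> R) : Prop :=
  forall v : dd_node D,
    \sum_a z a * ((dd_head a == v)%:R - (dd_tail a == v)%:R) =
    (v == dd_term D)%:R - (v == dd_root D)%:R.

Lemma incidence_unit_flow {R : realType} {n : nat} (D : decision_diagram n)
    (z : 'cV[R]_#|dd_arc D|) :
  incidence R D *m z = flow_balance R D ->
  unit_flow D (fun a => z (enum_rank a) 0).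
Proof.
move=> hz v.
have := congr1 (fun M : 'cV[R]_#|dd_node D| => M (enum_rank v) 0) hz.
rewrite !mxE enum_rankK => <-.
rewrite (reindex_onto enum_val enum_rank) /=; last by move=> a _; rewrite enum_rankK.
apply: eq_big => [j|j _]; first by rewrite enum_valK eqxx.
by rewrite !mxE enum_valK enum_rankK mulrC.
Qed.

Lemma sum_indicator {R : realType} {I : finType} (f : I -> R) (u : I) :
  \sum_v f v * (u == v)%:R = f u.
Proof.
rewrite (bigD1 u) //= eqxx mulr1 big1 ?addr0 // => v vu.
by rewrite eq_sym (negbTE vu) mulr0.
Qed.

(** Summation by parts: the conservation laws weighted by a potential. *)
Lemma flow_potential {R : realType} {n : nat} (D : decision_diagram n)
    (z : dd_arc D -> R) (phi : dd_node D -> R) :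
  unit_flow D z ->
  \sum_a z a * (phi (dd_head a) - phi (dd_tail a)) =
  phi (dd_term D) - phi (dd_root D).
Proof.
move=> hz.
have -> : phi (dd_term D) - phi (dd_root D) =
    \sum_v phi v * ((v == dd_term D)%:R - (v == dd_root D)%:R).
  under eq_bigr do rewrite mulrBr ![_ == dd_term D]eq_sym ![_ == dd_root D]eq_sym.
  by rewrite sumrB !sum_indicator.
under [RHS]eq_bigr do rewrite -hz big_distrr.
rewrite exchange_big /=; apply: eq_bigr => a _.
under eq_bigr do rewrite mulrCA mulrBr.
by rewrite -big_distrr /= sumrB !sum_indicator.
Qed.

(** The cut identity is [flow_potential] for the potential that is 1 up to
    layer [i] and 0 after it: exactly the arcs leaving layer [i] see it drop. *)
Lemma layer_flow {R : realType} {n : nat} (D : decision_diagram n)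
    (z : dd_arc D -> R) (i : 'I_n) :
  unit_flow D z ->
  \sum_(a | (dd_layer (dd_tail a) : nat) == i) z a = 1.
Proof.
move=> /(@flow_potential _ _ _ _ (fun v => ((dd_layer v <= i)%N)%:R)).
have -> : dd_layer (dd_term D) = ord_max by apply/dd_layer_last.
have -> : dd_layer (dd_root D) = ord0 by apply/dd_layer_first.
rewrite /= leqNgt ltn_ord /= sub0r => h.
apply: oppr_inj; rewrite -h -sumrN big_mkcond /=; apply: eq_bigr => a _.
rewrite dd_arc_layer; case: ltngtP => _ /=.
- by rewrite subrr mulr0.
- by rewrite subrr mulr0.
- by rewrite sub0r mulrN1.
Qed.

(** By conservation, positive inflow at a non-terminal node forces positive
    outflow. *)
Lemma support_continues {R : realType} {n : nat} (D : decision_diagram n)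
    (z : dd_arc D -> R) (v : dd_node D) :
  unit_flow D z -> (forall a, 0 <= z a) -> v != dd_term D ->
  v = dd_root D \/ (exists a, dd_head a = v /\ 0 < z a) ->
  exists a, (dd_tail a == v) && (0 < z a).
Proof.
move=> hz z0 vt hv; apply/existsP; apply: contraT; rewrite negb_exists => /forallP no.
have zt a : z a * (dd_tail a == v)%:R = 0.
  have := no a; case: eqP => [_ /= | _ _]; last by rewrite mulr0.
  by rewrite -leNgt => za; rewrite mulr1; apply/le_anti; rewrite za z0.
have := hz v.
under eq_bigr do rewrite mulrBr zt subr0.
rewrite (negbTE vt) sub0r => h.
have in0 a : 0 <= z a * (dd_head a == v)%:R by rewrite mulr_ge0.
case: hv => [vr | [a [ha za]]].
- have : 0 <= - (v == dd_root D)%:R :> R by rewrite -h sumr_ge0.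
  by rewrite vr eqxx oppr_ge0 ler10.
- have : 0 < - (v == dd_root D)%:R :> R.
    rewrite -h (bigD1 a) //= ha eqxx mulr1.
    by rewrite ltr_wpDr // sumr_ge0.
  by rewrite oppr_gt0 ltNge ler0n.
Qed.

(** * Cheapest paths in the support of a flow *)

(** Least cost of a walk of [k] support arcs from [v], by dynamic programming.
    At a node without an outgoing support arc the value is 0 by default; by
    conservation the terminal is the only such node that a support arc
    enters. *)
Fixpoint cost_to_go {R : realType} {n : nat} (D : decision_diagram n)
    (z w : dd_arc D -> R) (k : nat) (v : dd_node D) : R :=
  if k is k'.+1 then
    if [pick a | (dd_tail a == v) && (0 < z a)] is Some a0 then
      let cost a := w a + cost_to_go D z w k' (dd_head a) in
      cost [arg min_(a < a0 | (dd_tail a == v) && (0 < z a)) cost a]%O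
    else 0
  else 0.

(** All walks from [v] to the terminal have the same length, so the number of
    steps of [cost_to_go] is a function of [v]. *)
Definition potential {R : realType} {n : nat} (D : decision_diagram n)
    (z w : dd_arc D -> R) (v : dd_node D) : R :=
  cost_to_go D z w (n - dd_layer v) v.

Lemma potential_term {R : realType} {n : nat} (D : decision_diagram n)
    (z w : dd_arc D -> R) : potential D z w (dd_term D) = 0.
Proof.
rewrite /potential.
have -> : dd_layer (dd_term D) = ord_max by apply/dd_layer_last.
by rewrite /= subnn.
Qed.

Lemma layers_left {n : nat} (D : decision_diagram n) (a : dd_arc D) :
  (n - dd_layer (dd_tail a) = (n - dd_layer (dd_head a)).+1)%N.
Proof.
have := ltn_ord (dd_layer (dd_head a)); rewrite ltnS dd_arc_layer => h.
by rewrite -subSn // subSS.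
Qed.

(** Bellman's equation.  The two halves serve opposite purposes: the inequality
    over all support arcs bounds the cost of the flow below, while an arc of
    equality is a step of a cheapest path. *)
Lemma potential_bellman {R : realType} {n : nat} (D : decision_diagram n)
    (z w : dd_arc D -> R) (v : dd_node D) :
  (exists a, (dd_tail a == v) && (0 < z a)) ->
  exists2 a, (dd_tail a == v) && (0 < z a) &
    potential D z w v = w a + potential D z w (dd_head a) /\
    forall b, (dd_tail b == v) && (0 < z b) ->
      potential D z w v <= w b + potential D z w (dd_head b).
Proof.
move=> [a1 ha1].
pose k := (n - dd_layer v).-1.
have kE b : (dd_tail b == v) && (0 < z b) -> (n - dd_layer (dd_head b))%N = k.
  by move=> /andP[/eqP bv _]; rewrite /k -bv layers_left.
have vE : (n - dd_layer v)%N = k.+1.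
  by rewrite -(kE _ ha1) -layers_left; move/andP: ha1 => [/eqP -> _].
rewrite {1 3}/potential vE /=.
case: pickP => [a0 ha0 | no]; last by rewrite no in ha1.
case: arg_minP => // a ha amin; exists a => //; split.
  by rewrite /potential (kE _ ha).
by move=> b hb; rewrite /potential (kE _ hb); exact: amin.
Qed.

(** [flow_potential] gives [phi root = \sum_a z a * (phi (tail a) - phi (head a))],
    and Bellman's inequality bounds each term with [z a > 0] by [z a * w a]. *)
Lemma potential_root_le {R : realType} {n : nat} (D : decision_diagram n)
    (z w : dd_arc D -> R) :
  unit_flow D z -> (forall a, 0 <= z a) ->
  potential D z w (dd_root D) <= \sum_a z a * w a.
Proof.
move=> hz z0.
have := flow_potential D z (potential D z w) hz.
rewrite potential_term sub0r => h.
rewrite -[leLHS]opprK -h -sumrN; apply: ler_sum => a _.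
rewrite -mulrN opprB.
have := z0 a; rewrite le_eqVlt => /predU1P[<- | za]; first by rewrite !mul0r.
rewrite ler_pM2l // lerBlDr.
have ha : (dd_tail a == dd_tail a) && (0 < z a) by rewrite eqxx za.
have [_ _ [_]] := potential_bellman D z w (dd_tail a) (ex_intro _ a ha).
exact.
Qed.

(** Following minimizers of Bellman's equation; the walk can only stop at the
    terminal because the support is left by every node it enters. *)
Lemma optimal_support_walk {R : realType} {n : nat} (D : decision_diagram n)
    (z w : dd_arc D -> R) :
  unit_flow D z -> (forall a, 0 <= z a) ->
  forall (k : nat) (v : dd_node D), (dd_layer v + k)%N = n ->
  v = dd_root D \/ (exists a, dd_head a = v /\ 0 < z a) ->
  exists s : seq (dd_arc D),
    [/\ size s = k, dd_walk v s (dd_term D), all (fun a => 0 < z a) s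
      & \sum_(a <- s) w a = potential D z w v].
Proof.
move=> hz z0; elim=> [|k IH] v vk hv.
  have -> : v = dd_term D.
    by apply/dd_layer_last/val_inj; rewrite /= -[RHS]vk addn0.
  by exists [::]; split=> //; rewrite big_nil potential_term.
have vt : v != dd_term D.
  apply: contra_eqN vk => /eqP ->.
  have -> : dd_layer (dd_term D) = ord_max by apply/dd_layer_last.
  by rewrite neq_ltn addnS ltnS leq_addr orbT.
have [a /andP[/eqP av za] [aE _]] :=
  potential_bellman D z w v (support_continues D z v hz z0 vt hv).
have [||s [sk sw sz sE]] := IH (dd_head a).
- by rewrite dd_arc_layer av addSnnS.
- by right; exists a.
exists (a :: s); split=> //=; first by rewrite sk.
- by rewrite za.
- by rewrite big_cons sE aE.
Qed.

(** * From flows to path vectors *)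

Lemma dotE {R : realType} {k : nat} (u v : 'cV[R]_k) :
  dot u v = \sum_i u i 0 * v i 0.
Proof. by rewrite /dot mxE; apply: eq_bigr => i _; rewrite mxE. Qed.

Lemma walk_layer {n : nat} (D : decision_diagram n) (a0 : dd_arc D)
    (s : seq (dd_arc D)) (v u : dd_node D) (i : nat) :
  dd_walk v s u -> (i < size s)%N ->
  (dd_layer (dd_tail (nth a0 s i)) : nat) = (dd_layer v + i)%N.
Proof.
elim: s v i => [//|a s IH] v [|i] /= [av hs] hi; first by rewrite av addn0.
by rewrite (IH _ _ hs hi) dd_arc_layer av addSnnS.
Qed.

Lemma path_layer {n : nat} (D : decision_diagram n)
    (r : n.-tuple (dd_arc D)) (i : 'I_n) :
  dd_path r -> (dd_layer (dd_tail (tnth r i)) : nat) = i.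
Proof.
move=> hr; rewrite (tnth_nth (tnth r i)).
rewrite (walk_layer D _ _ _ _ _ hr) ?size_tuple //.
by have -> : dd_layer (dd_root D) = ord0 by apply/dd_layer_first.
Qed.

Definition supported_path {R : realType} {n : nat} (D : decision_diagram n)
    (z : dd_arc D -> R) (r : n.-tuple (dd_arc D)) : Prop :=
  dd_path r /\ forall i, 0 < z (tnth r i).

Definition label_flow {R : realType} {n : nat} (D : decision_diagram n)
    (z : dd_arc D -> R) : 'cV[R]_n :=
  \col_i \sum_(a | ((dd_layer (dd_tail a) : nat) == i) && dd_label a) z a.

(** The cheapest path in the support is no more expensive than the flow, for
    the arc costs that charge [xi i] to the arcs labelled 1 leaving layer [i]. *)
Lemma cheap_support_path {R : realType} {n : nat} (D : decision_diagram n)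
    (z : dd_arc D -> R) (xi : 'cV[R]_n) :
  unit_flow D z -> (forall a, 0 <= z a) ->
  exists2 r, supported_path D z r &
    dot xi (dd_path_vector R r) <= dot xi (label_flow D z).
Proof.
move=> hz z0.
pose w (a : dd_arc D) : R :=
  \sum_(i < n | (dd_layer (dd_tail a) : nat) == i) (dd_label a)%:R * xi i 0.
have r0 : (dd_layer (dd_root D) + n)%N = n.
  by have -> : dd_layer (dd_root D) = ord0 by apply/dd_layer_first.
have [s [sn sw sz sE]] :=
  optimal_support_walk D z w hz z0 _ _ r0 (or_introl erefl).
have sn' : size s == n by rewrite sn.
pose r := Tuple sn'.
have hr : dd_path r by [].
exists r.
  by split=> // i; apply: (allP sz); exact: (mem_tnth i r).
have -> : dot xi (dd_path_vector R r) = \sum_(a <- r) w a.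
  rewrite dotE big_tuple; apply: eq_bigr => i _.
  rewrite /w mxE (big_pred1 i) 1?mulrC // => j /=.
  by rewrite path_layer // eq_sym.
have -> : dot xi (label_flow D z) = \sum_a z a * w a.
  rewrite dotE; under eq_bigr do rewrite mxE big_distrr /= big_mkcond.
  rewrite exchange_big /=; apply: eq_bigr => a _.
  rewrite /w big_distrr /= [RHS]big_mkcond; apply: eq_bigr => i _.
  case: ifP; case: ifP => //=; case: (dd_label a) => //=.
  - by rewrite mul1r mulrC.
  - by rewrite mul0r mulr0.
by rewrite sE; exact: potential_root_le.
Qed.

(** If coordinate [i] of the flow is 0, no support arc leaving layer [i] has
    label 1; if it is 1, it exhausts the unit of flow crossing layer [i], and
    no support arc leaving this layer has label 0. *)
Lemma support_path_fixed {R : realType} {n : nat} (D : decision_diagram n)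
    (z : dd_arc D -> R) (r : n.-tuple (dd_arc D)) (i : 'I_n) :
  unit_flow D z -> (forall a, 0 <= z a) -> supported_path D z r ->
  (label_flow D z i 0 <= 0 -> dd_path_vector R r i 0 = 0) /\
  (1 <= label_flow D z i 0 -> dd_path_vector R r i 0 = 1).
Proof.
move=> hz z0 [hr zr].
have pos (b : bool) : dd_label (tnth r i) = b ->
    0 < \sum_(a | ((dd_layer (dd_tail a) : nat) == i) && (dd_label a == b)) z a.
  move=> hb; rewrite (bigD1 (tnth r i)) /=; last by rewrite path_layer // hb !eqxx.
  by rewrite ltr_wpDr // sumr_ge0.
have := layer_flow D z i hz; rewrite (bigID (fun a => dd_label a)) /= => H.
rewrite !mxE; case E: (dd_label (tnth r i)); split=> //.
- move=> le0; have := pos _ E.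
  under eq_bigl do rewrite eqb_id.
  by rewrite ltNge le0.
- move=> ge1; have := pos _ E.
  under eq_bigl do rewrite eqbF_neg.
  by rewrite ltNge -(lerD2l 1) addr0 -[leRHS]H lerD2r ge1.
Qed.

(** * Recourse decisions and weak duality *)

(** With [x] binary, a linking constraint met by [y] is either void on binary
    vectors or fixes a coordinate at 0 or 1. *)
Lemma selective_fixed {R : realType} {m n : nat}
    (U1 U2 U3 : {set 'I_n * 'I_m}) (x : 'cV[R]_m) (y y' : 'cV[R]_n) :
  binary x -> binary y' -> selective U1 U2 U3 x y ->
  (forall i, (y i 0 <= 0 -> y' i 0 = 0) /\ (1 <= y i 0 -> y' i 0 = 1)) ->
  selective U1 U2 U3 x y'.
Proof.
move=> bx by' [h1 h2 h3] fx.
have b01 i : 0 <= y' i 0 <= 1 by case: (by' i) => ->; rewrite ?lexx ?ler01.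
split=> i j ij; have [f0 f1] := fx i; have /andP[y0 y1] := b01 i.
- by have := h1 _ _ ij; case: (bx j) => -> // /f0 ->.
- by have := h2 _ _ ij; case: (bx j) => -> yE; [apply: f0 | apply: f1]; rewrite yE.
- by have := h3 _ _ ij; case: (bx j) => -> // /f1 ->.
Qed.

Lemma weak_duality {R : realType} {p n : nat} (T : 'M[R]_(p, n))
    (d lam : 'cV[R]_p) (xi : 'cV[R]_n) :
  uncertainty_set T d xi -> vle 0 lam -> dot xi (T^T *m lam) <= dot d lam.
Proof.
move=> hxi lam0.
have -> : dot xi (T^T *m lam) = dot (T *m xi) lam.
  by rewrite /dot trmx_mul mulmxA.
rewrite !dotE; apply: ler_sum => i _; apply: ler_wpM2r; last exact: hxi.
by have := lam0 i; rewrite mxE.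
Qed.

(** Rounding [y] to a single path, chosen for the given [xi]: cheapness comes
    from [cheap_support_path], membership in [Y] from the diagram, and the
    linking constraints from [support_path_fixed]. *)
Lemma integral_recourse {R : realType} {m n : nat} (D : decision_diagram n)
    (Y : set 'cV[R]_n) (U1 U2 U3 : {set 'I_n * 'I_m})
    (x : 'cV[R]_m) (y xi : 'cV[R]_n) :
  dd_solutions D `<=` Y -> binary x ->
  proj_y_network_flow D y -> selective U1 U2 U3 x y ->
  exists2 y', (Y `&` selective U1 U2 U3 x) y' & dot xi y' <= dot xi y.
Proof.
move=> DY bx [[u zv] /= [/= z0 hz yE] <-] Sy.
have hf := incidence_unit_flow D zv hz.
set z := (fun a => zv (enum_rank a) 0) in hf.
have zge a : 0 <= z a by have := z0 (enum_rank a); rewrite mxE.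
have yz : u = label_flow D z.
  apply/matrixP => i k; rewrite ord1 yE mxE.
  rewrite (reindex_onto enum_rank enum_val) /=; last by move=> j _; rewrite enum_valK.
  by apply: eq_bigl => a; rewrite enum_rankK eqxx andbT.
have [r sr le_r] := cheap_support_path D z xi hf zge.
exists (dd_path_vector R r); last by rewrite yz.
split; first by apply: DY; exists r => //; case: sr.
apply: (selective_fixed _ _ _ _ _ _ bx _ Sy) => i.
  by rewrite mxE; case: (dd_label _); [right|left].
rewrite yz; exact: support_path_fixed.
Qed.

Theorem proposition4 (R : realType) (m n p q : nat)
  (hm : (0 < m)%N) (hn : (0 < n)%N)
  (c : 'cV[R]_m)
  (X : set 'cV[R]_m) (hX : X `<=` @binary R m)
  (G : 'M[R]_(q, n)) (h : 'cV[R]_q)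
  (T : 'M[R]_(p, n)) (d : 'cV[R]_p)
  (hXi0 : uncertainty_set T d !=set0)
  (hXib : bounded_set (uncertainty_set T d))
  (U1 U2 U3 : {set 'I_n * 'I_m})
  (hU12 : U1 :&: U2 = finset.set0) (hU13 : U1 :&: U3 = finset.set0)
  (hU23 : U2 :&: U3 = finset.set0)
  (D : decision_diagram n)
  (hD : restricted_dd D (binary_polyhedral G h)) :
  (forall (x : 'cV[R]_m) (y : 'cV[R]_n) (lam : 'cV[R]_p),
     model_optimal c T d X (selective U1 U2 U3) D (x, y, lam) ->
     robust_feasible X (binary_polyhedral G h) (selective U1 U2 U3) x) /\
  (robust_value c X (binary_polyhedral G h) (uncertainty_set T d)
     (selective U1 U2 U3)
   <= model_value c T d X (selective U1 U2 U3) D)%E.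
Proof.
have recourse x y lam xi : model_feasible T X (selective U1 U2 U3) D (x, y, lam) ->
    exists2 y', (binary_polyhedral G h `&` selective U1 U2 U3 x) y' &
      dot xi y' <= dot xi y.
  case=> _ yD Sy Xx _.
  exact: (integral_recourse D _ _ _ _ _ _ _ (properW hD) (hX _ Xx) yD Sy).
split=> [x y lam [feas _] | ].
  (* Feasibility does not depend on the scenario, hence the arbitrary 0. *)
  have [y' hy' _] := recourse _ _ _ 0 feas.
  by split; [case: feas | exists y'].
apply: le_ereal_inf_tmp => _ [[[x y] lam] feas <-].
apply: ge_ereal_inf; exists (worst_case_value c (binary_polyhedral G h)
  (uncertainty_set T d) (selective U1 U2 U3) x).
  by exists x => //; case: feas.
apply: ge_ereal_sup => _ [xi hxi <-].
have [y' hy' le_y] := recourse _ _ _ xi feas.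
apply: ge_ereal_inf; exists (dot c x + dot xi y')%:E; first by exists y'.
rewrite lee_fin /= lerD2l; apply: le_trans le_y _.
case: feas => <- _ _ _ lam0; exact: weak_duality.
Qed.
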